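(* Given time-dependent correlations $\rho(t)\in[-1,+1]$, $t\in\mathbb{R}^+$, define $$Z(t):=\frac{\rho(t)}{\sqrt{2t\,[1-\rho^2(t)]}},\qquad \Pi^{\pm}(x,t):=\frac{e^{-\frac{x^2}{2t}}}{2\sqrt{2\pi t}}\left\{1\pm\mathrm{Erf}[Z(t)x]\right\}.$$ Then the skew-normal law $\Pi^{\pm}(x,t)$ solves the parabolic partial differential equation $$\partial_t\Pi^{\pm}(x,t)=-\partial_x\left[f^{\pm}_{\psi}(x,t)\,\Pi^{\pm}(x,t)\right]+\frac12\,\partial_{xx}\left[\Pi^{\pm}(x,t)\right],\qquad f^{\pm}_{\psi}(x,t):=\psi(t)\,\partial_x\ln\left\{1\pm\mathrm{Erf}[Z(t)x]\right\},$$ where $\psi(t)$ is given by $$\psi(t)=\frac12+t\,\partial_t\left[\ln\rho(t)\right].$$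
   Context: $\mathrm{Erf}(x)=\frac{2}{\sqrt\pi}\int_0^x e^{-s^2}\,ds$ is the error function. The function $\rho(t)$ is the time-dependent correlation between the two components of a centred bivariate Gaussian diffusion $(X_t,Y_t)$ started at $(0,0)$, whose first component $X_t$ is a standard Brownian motion (variance $t$); $\Pi^\pm(\cdot,t)$ is the corresponding truncated marginal in $x$, obtained by integrating the joint density over $y\in\mathbb{R}^{\pm}$. *)

(* Defs.v *)
From Stdlib Require Import Reals.
From Coquelicot Require Import Coquelicot.
Open Scope R_scope.

Definition Erf (x : R) : R :=
  2 / sqrt PI * RInt (fun s => exp (- s ^ 2)) 0 x.

Definition Zfun (rho : R -> R) (t : R) : R :=
  rho t / sqrt (2 * t * (1 - rho t ^ 2)).

(* Throughout, [e] is the sign of the superscript: 1 for "+", -1 for "-". *)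

Definition erf_factor (e : R) (rho : R -> R) (x t : R) : R :=
  1 + e * Erf (Zfun rho t * x).

Definition Pi_skew (e : R) (rho : R -> R) (x t : R) : R :=
  exp (- x ^ 2 / (2 * t)) / (2 * sqrt (2 * PI * t)) * erf_factor e rho x t.

(* The correlation may be negative, while the real [ln] is the junk value 0 on
   nonpositive arguments: the absolute value makes the derivative the
   logarithmic derivative of [rho] for either sign of [rho t]. *)
Definition psi (rho : R -> R) (t : R) : R :=
  1 / 2 + t * Derive (fun s => ln (Rabs (rho s))) t.

Definition drift (e : R) (rho : R -> R) (x t : R) : R :=
  psi rho t * Derive (fun y => ln (erf_factor e rho y t)) x.

(* [u] solves [d_t u = - d_x (f u) + 1/2 d_xx u] classically at time [t].
   [Derive] is total, so the existence of every derivative that occurs is part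
   of the definition. *)
Definition solves_FP_at (f u : R -> R -> R) (t : R) : Prop :=
  forall x : R,
    ex_derive (fun s => u x s) t /\
    ex_derive (fun y => f y t * u y t) x /\
    ex_derive (fun y => u y t) x /\
    ex_derive (Derive (fun y => u y t)) x /\
    Derive (fun s => u x s) t =
      - Derive (fun y => f y t * u y t) x
      + 1 / 2 * Derive_n (fun y => u y t) 2 x.

(* Main.v *)
Require Import Defs.
From Stdlib Require Import Reals Psatz.
From Coquelicot Require Import Coquelicot.
Open Scope R_scope.

(** Put [F = 1 + e Erf (Z x)] and let [G] be half the heat kernel, so that
    [Pi = G F] and [f Pi = psi G d_x F].  Since [d_t G = 1/2 d_xx G],
    [d_x G = - (x / t) G], [d_xx F = - 2 Z^2 x d_x F] and
    [d_t F = (Z' / Z) x d_x F], the equation reduces to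
    [Z' / Z = psi (1 / t + 2 Z^2) - 1 / t - Z^2], an identity between rational
    functions of [t], [rho] and [rho'].  The drift makes sense because
    [|Erf| < 1], which follows from the constancy in [x] of
    [(int_0^x e^{-s^2} ds)^2 + int_0^1 e^{-x^2 (1 + u^2)} / (1 + u^2) du]. *)

(** * The Gaussian integral and the strict bound on [Erf] *)

Lemma ex_RInt_gauss (a b : R) : ex_RInt (fun s => exp (- s ^ 2)) a b.
Proof.
  apply (ex_RInt_continuous (V := R_CompleteNormedModule)); intros z _.
  apply (ex_derive_continuous (fun s => exp (- s ^ 2))); auto_derive; auto.
Qed.

Lemma is_derive_gauss_RInt (x : R) :
  is_derive (fun y => RInt (fun s => exp (- s ^ 2)) 0 y) x (exp (- x ^ 2)).
Proof.
  apply (is_derive_RInt (fun s => exp (- s ^ 2)) _ 0 x).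
  - apply filter_forall; intro b.
    apply (RInt_correct (V := R_CompleteNormedModule) (fun s => exp (- s ^ 2))), ex_RInt_gauss.
  - apply (ex_derive_continuous (fun s => exp (- s ^ 2))); auto_derive; auto.
Qed.

(** Differentiation in [x] cancels the denominator and leaves a pure exponential, while at [x = 0]
    only the derivative of [atan] remains. *)
Definition gauss_aux (x u : R) : R := exp (- (x ^ 2 * (1 + u ^ 2))) / (1 + u ^ 2).

Lemma continuous_gauss_aux (x u : R) : continuous (gauss_aux x) u.
Proof.
  apply (ex_derive_continuous (gauss_aux x)); unfold gauss_aux; auto_derive.
  nra.
Qed.

Lemma is_derive_gauss_aux (x u : R) :
  is_derive (fun y => gauss_aux y u) x (- 2 * x * exp (- (x ^ 2 * (1 + u ^ 2)))).
Proof.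
  unfold gauss_aux; auto_derive; [nra|].
  replace (x * (x * 1) * (1 + u * (u * 1))) with (x ^ 2 * (1 + u ^ 2)) by ring.
  field; nra.
Qed.

(** Differentiate under the integral sign, pull out [exp (- x ^ 2)] and substitute [s = x u]. The
    result is the opposite of the derivative of the squared Gaussian integral. *)
Lemma is_derive_gauss_aux_RInt (x : R) :
  is_derive (fun y => RInt (gauss_aux y) 0 1) x
    (- 2 * exp (- x ^ 2) * RInt (fun s => exp (- s ^ 2)) 0 x).
Proof.
  replace (- 2 * exp (- x ^ 2) * RInt (fun s => exp (- s ^ 2)) 0 x)
    with (RInt (fun u => Derive (fun y => gauss_aux y u) x) 0 1).
  - apply (is_derive_RInt_param gauss_aux 0 1 x).
    + apply filter_forall; intros y u _; eexists; apply is_derive_gauss_aux.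
    (* Differentiation under the integral needs joint continuity of the partial derivative, which is
       checked on its closed form. *)
    + intros u _.
      apply continuity_2d_pt_ext
        with (fun y v => - 2 * y * exp (- (y ^ 2 * (1 + v ^ 2)))).
      * intros y v; symmetry; apply is_derive_unique, is_derive_gauss_aux.
      * apply continuity_2d_pt_mult.
        -- apply continuity_2d_pt_mult;
             [apply continuity_2d_pt_const | apply continuity_2d_pt_id1].
        -- apply (continuity_1d_2d_pt_comp exp
                    (fun y v => - (y ^ 2 * (1 + v ^ 2)))).
           ++ apply derivable_continuous_pt, derivable_pt_exp.
           ++ apply continuity_2d_pt_opp, continuity_2d_pt_mult.
              ** apply (continuity_1d_2d_pt_comp (fun z => z ^ 2) (fun y _ => y));
                   [|apply continuity_2d_pt_id1].
                 apply derivable_continuous_pt, derivable_pt_pow.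
              ** apply continuity_2d_pt_plus; [apply continuity_2d_pt_const|].
                 apply (continuity_1d_2d_pt_comp (fun z => z ^ 2) (fun _ v => v));
                   [|apply continuity_2d_pt_id2].
                 apply derivable_continuous_pt, derivable_pt_pow.
    + apply filter_forall; intro y.
      apply (ex_RInt_continuous (V := R_CompleteNormedModule) (gauss_aux y)); intros; apply continuous_gauss_aux.
  - pose proof (RInt_comp_lin (fun s => exp (- s ^ 2)) x 0 0 1
                  (ex_RInt_gauss _ _)) as H.
    rewrite Rmult_0_r, Rmult_1_r, !Rplus_0_r in H.
    rewrite <- H, <- (RInt_scal (V := R_CompleteNormedModule)).
    + apply RInt_ext; intros u _.
      transitivity (- 2 * x * exp (- (x ^ 2 * (1 + u ^ 2))));
        [apply is_derive_unique, is_derive_gauss_aux|].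
      replace (- (x ^ 2 * (1 + u ^ 2))) with (- x ^ 2 + - (x * u + 0) ^ 2) by ring.
      rewrite exp_plus; unfold scal; simpl; unfold mult; simpl; ring.
    + apply (ex_RInt_comp_lin (fun s => exp (- s ^ 2))), ex_RInt_gauss.
Qed.

Lemma gauss_aux_RInt_0 : RInt (gauss_aux 0) 0 1 = PI / 4.
Proof.
  apply is_RInt_unique.
  replace (PI / 4) with (minus (atan 1) (atan 0))
    by (rewrite atan_1, atan_0; unfold minus, plus, opp; simpl; ring).
  assert (Hu : forall u, / (1 + u²) = gauss_aux 0 u).
  { intro u; unfold gauss_aux, Rsqr.
    replace (- (0 ^ 2 * (1 + u ^ 2))) with 0 by ring.
    rewrite exp_0; field; nra. }
  apply is_RInt_ext with (fun u => / (1 + u²)); [intros; apply Hu|].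
  apply (is_RInt_derive atan); intros u _; [apply is_derive_atan|].
  apply (ex_derive_continuous (fun v => / (1 + v²))).
  unfold Rsqr; auto_derive; nra.
Qed.

Lemma gauss_RInt_sqr (x : R) :
  RInt (fun s => exp (- s ^ 2)) 0 x ^ 2 + RInt (gauss_aux x) 0 1 = PI / 4.
Proof.
  set (g y := RInt (fun s => exp (- s ^ 2)) 0 y ^ 2 + RInt (gauss_aux y) 0 1).
  assert (Hg : forall y, is_derive g y zero).
  { intro y; unfold g.
    pose proof (is_derive_gauss_RInt y) as H1.
    pose proof (is_derive_gauss_aux_RInt y) as H2.
    replace (@zero R_NormedModule)
      with (plus (2 * exp (- y ^ 2) * RInt (fun s => exp (- s ^ 2)) 0 y ^ 1)
                 (- 2 * exp (- y ^ 2) * RInt (fun s => exp (- s ^ 2)) 0 y))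
      by (unfold plus, zero; simpl; ring).
    apply (is_derive_plus (fun y => RInt (fun s => exp (- s ^ 2)) 0 y ^ 2)); [|exact H2].
    exact (is_derive_pow _ 2 y _ H1). }
  assert (H0 : g 0 = PI / 4).
  { unfold g; rewrite RInt_point, gauss_aux_RInt_0; unfold zero; simpl; ring. }
  change (g x = PI / 4); rewrite <- H0.
  (* [eq_is_derive] compares the endpoints of a nondegenerate interval, hence the split on the sign
     of [x]. *)
  destruct (Rtotal_order x 0) as [Hx | [-> | Hx]]; [| reflexivity |].
  - apply (eq_is_derive g); auto.
  - symmetry; apply (eq_is_derive g); auto.
Qed.

Lemma Erf_bound (x : R) : -1 < Erf x < 1.
Proof.
  assert (Hpi := PI_RGT_0).
  assert (Hs : 0 < sqrt PI) by (apply sqrt_lt_R0; lra).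
  assert (Hpos : 0 < RInt (gauss_aux x) 0 1).
  { apply RInt_gt_0; [lra| |intros; apply continuous_gauss_aux].
    intros u _; apply Rdiv_lt_0_compat; [apply exp_pos | nra]. }
  (* By [gauss_RInt_sqr], the square is [1] minus [4 / PI] times a positive integral. *)
  assert (H : Erf x ^ 2 < 1 ^ 2).
  { unfold Erf; rewrite Rpow_mult_distr.
    replace ((2 / sqrt PI) ^ 2) with (4 / PI).
    - replace (RInt _ 0 x ^ 2) with (PI / 4 - RInt (gauss_aux x) 0 1)
        by (rewrite <- (gauss_RInt_sqr x); ring).
      assert (0 < 4 / PI * RInt (gauss_aux x) 0 1)
        by (apply Rmult_lt_0_compat; auto; apply Rdiv_lt_0_compat; lra).
      replace (4 / PI * (PI / 4 - RInt (gauss_aux x) 0 1))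
        with (1 - 4 / PI * RInt (gauss_aux x) 0 1) by (field; lra).
      lra.
    - rewrite <- (pow2_sqrt PI) at 1 by lra; field; lra. }
  nra.
Qed.

(** * Derivatives of the error-function factor in space and time *)

Lemma is_derive_Erf (x : R) : is_derive Erf x (2 / sqrt PI * exp (- x ^ 2)).
Proof. apply (is_derive_scal _ x (2 / sqrt PI)), is_derive_gauss_RInt. Qed.

Lemma erf_factor_pos (e : R) (rho : R -> R) (x t : R) :
  e = 1 \/ e = -1 -> 0 < erf_factor e rho x t.
Proof.
  intros He; unfold erf_factor.
  pose proof (Erf_bound (Zfun rho t * x)); destruct He; subst; lra.
Qed.

(** The time derivative of [erf_factor] and the space derivative of this function are both multiples
    of it, so the final equation is linear in the two quantities [erf_factor] and
    [erf_factor_dx]. *)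
Definition erf_factor_dx (e : R) (rho : R -> R) (x t : R) : R :=
  e * (2 / sqrt PI) * Zfun rho t * exp (- (Zfun rho t * x) ^ 2).

Lemma is_derive_erf_factor_x (e : R) (rho : R -> R) (x t : R) :
  is_derive (fun y => erf_factor e rho y t) x (erf_factor_dx e rho x t).
Proof.
  unfold erf_factor.
  pose proof (is_derive_Erf (Zfun rho t * x)) as H.
  auto_derive.
  - eexists; exact H.
  - change (fun x0 : R => Erf x0) with Erf.
    rewrite (is_derive_unique _ _ _ H); unfold erf_factor_dx; ring.
Qed.

Lemma is_derive_erf_factor_dx (e : R) (rho : R -> R) (x t : R) :
  is_derive (fun y => erf_factor_dx e rho y t) x
    (- 2 * Zfun rho t ^ 2 * x * erf_factor_dx e rho x t).
Proof.
  unfold erf_factor_dx; auto_derive; [auto|].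
  replace (Zfun rho t * x * (Zfun rho t * x * 1))
    with ((Zfun rho t * x) ^ 2) by ring.
  unfold Rdiv; ring.
Qed.

(** Squaring removes the root, which makes the final identity rational. *)
Lemma Zfun_sqr (rho : R -> R) (t : R) :
  0 < t -> -1 < rho t < 1 ->
  Zfun rho t ^ 2 = rho t ^ 2 / (2 * t * (1 - rho t ^ 2)).
Proof.
  intros Ht Hr; unfold Zfun.
  assert (0 < 1 - rho t ^ 2) by nra.
  assert (Hp : 0 < 2 * t * (1 - rho t ^ 2)) by nra.
  assert (0 < sqrt (2 * t * (1 - rho t ^ 2))) by (apply sqrt_lt_R0; lra).
  rewrite <- (pow2_sqrt (2 * t * (1 - rho t ^ 2))) at 2 by lra.
  field; lra.
Qed.

(** Logarithmic differentiation of [Z]: the terms [l / rho] and [rho l / (1 - rho ^ 2)] add up to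
    [l / (rho (1 - rho ^ 2))], and the factor [sqrt t] gives [- 1 / (2 t)]. *)
Lemma is_derive_Zfun (rho : R -> R) (t l : R) :
  0 < t -> -1 < rho t < 1 -> rho t <> 0 -> is_derive rho t l ->
  is_derive (Zfun rho) t
    (Zfun rho t * (l / (rho t * (1 - rho t ^ 2)) - / (2 * t))).
Proof.
  intros Ht Hr Hr0 Hl; unfold Zfun.
  assert (Hq : 0 < 1 - rho t ^ 2) by nra.
  assert (Hp : 0 < 2 * t * (1 - rho t ^ 2)) by nra.
  assert (Hs : 0 < sqrt (2 * t * (1 - rho t ^ 2))) by (apply sqrt_lt_R0; lra).
  auto_derive.
  - replace (1 + - (rho t * (rho t * 1))) with (1 - rho t ^ 2) by ring.
    repeat split; try (eexists; exact Hl); lra.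
  - change (fun x : R => rho x) with rho.
    rewrite (is_derive_unique _ _ _ Hl).
    replace (1 + - (rho t * (rho t * 1))) with (1 - rho t ^ 2) by ring.
    set (s := sqrt (2 * t * (1 - rho t ^ 2))) in *.
    assert (Hss : s ^ 2 = 2 * t * (1 - rho t ^ 2)) by (apply pow2_sqrt; lra).
    apply Rmult_eq_reg_r with (2 * t * (1 - rho t ^ 2) * rho t * s);
      [|repeat apply Rmult_integral_contrapositive_currified; lra].
    (* [field] treats [s] as an indeterminate, so the last quotient, equal to [1] by [Hss], is
       isolated first. *)
    transitivity (2 * t * (1 - rho t ^ 2) * rho t * l
       - rho t * (2 * (1 - rho t ^ 2) - 4 * t * rho t * l) / 2 * rho t
         * ((2 * t * (1 - rho t ^ 2)) / s ^ 2)).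
    + field; lra.
    + rewrite <- Hss at 2; field; lra.
Qed.

Lemma is_derive_erf_factor_t (e : R) (rho : R -> R) (x t l : R) :
  0 < t -> -1 < rho t < 1 -> rho t <> 0 -> is_derive rho t l ->
  is_derive (fun s => erf_factor e rho x s) t
    (x * (l / (rho t * (1 - rho t ^ 2)) - / (2 * t)) * erf_factor_dx e rho x t).
Proof.
  intros Ht Hr Hr0 Hl.
  pose proof (is_derive_Zfun rho t l Ht Hr Hr0 Hl) as HZ.
  pose proof (is_derive_Erf (Zfun rho t * x)) as H.
  unfold erf_factor; auto_derive.
  - repeat split; eexists; [exact H | exact HZ].
  - change (fun x0 : R => Erf x0) with Erf.
    change (fun x0 : R => Zfun rho x0) with (Zfun rho).
    rewrite (is_derive_unique _ _ _ H), (is_derive_unique _ _ _ HZ).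
    unfold erf_factor_dx; ring.
Qed.

(** * Derivatives of half the heat kernel *)

Definition half_heat (x t : R) : R :=
  exp (- x ^ 2 / (2 * t)) / (2 * sqrt (2 * PI * t)).

Lemma is_derive_half_heat_x (x t : R) :
  0 < t -> is_derive (fun y => half_heat y t) x (- (x / t) * half_heat x t).
Proof.
  intros Ht; unfold half_heat.
  assert (0 < sqrt (2 * PI * t))
    by (apply sqrt_lt_R0; pose proof PI_RGT_0; nra).
  auto_derive; [auto|].
  replace (- (x * (x * 1)) * / (2 * t)) with (- x ^ 2 / (2 * t)) by (field; lra).
  field; lra.
Qed.

Lemma is_derive_half_heat_t (x t : R) :
  0 < t ->
  is_derive (fun s => half_heat x s) t
    ((x ^ 2 / (2 * t ^ 2) - / (2 * t)) * half_heat x t).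
Proof.
  intros Ht; unfold half_heat.
  assert (Hp : 0 < 2 * PI * t) by (pose proof PI_RGT_0; nra).
  assert (Hs : 0 < sqrt (2 * PI * t)) by (apply sqrt_lt_R0; lra).
  assert (Hss : sqrt (2 * PI * t) ^ 2 = 2 * PI * t) by (apply pow2_sqrt; lra).
  (* Eliminating [PI] in favour of the root turns the goal into a rational identity in [s], [t] and
     [x], up to the common exponential. *)
  assert (Hpi : PI = sqrt (2 * PI * t) ^ 2 / (2 * t)) by (rewrite Hss; field; lra).
  auto_derive.
  - repeat split; lra.
  - replace (- (x * (x * 1)) * / (2 * t)) with (- x ^ 2 / (2 * t)) by (field; lra).
    set (s := sqrt (2 * PI * t)) in *; clearbody s.
    rewrite Hpi; field; lra.
Qed.

(** The kernel stays a common factor: differentiation sends [g] to [g' - (x / t) g], a rule that can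
    be iterated. *)
Lemma is_derive_half_heat_mult (g : R -> R) (x t dg : R) :
  0 < t -> is_derive g x dg ->
  is_derive (fun y => half_heat y t * g y) x
    (half_heat x t * (dg - x / t * g x)).
Proof.
  intros Ht Hg.
  replace (half_heat x t * (dg - x / t * g x))
    with (plus (mult (- (x / t) * half_heat x t) (g x)) (mult (half_heat x t) dg))
    by (unfold plus, mult; simpl; ring).
  apply (is_derive_mult (fun y => half_heat y t) g); auto using is_derive_half_heat_x.
  intros; apply Rmult_comm.
Qed.

(** * The logarithmic derivatives behind [psi] and the drift *)

Lemma is_derive_ln_Rabs (f : R -> R) (x l : R) :
  f x <> 0 -> is_derive f x l -> is_derive (fun y : R => ln (Rabs (f y))) x (l / f x).
Proof.
  intros Hf Hl.
  pose proof (Rabs_pos_lt _ Hf) as Ha.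
  replace (l / f x) with (scal (sign (f x) * l) (/ Rabs (f x))).
  - apply (is_derive_comp ln (fun y => Rabs (f y))).
    + apply is_derive_Reals, derivable_pt_lim_ln, Ha.
    + apply is_derive_Rabs; assumption.
  - unfold scal; simpl; unfold mult; simpl.
    (* For either sign of [f x], [sign (f x) / Rabs (f x)] is [/ f x]. *)
    destruct (Rdichotomy _ _ Hf) as [H | H].
    + rewrite sign_eq_m1, Rabs_left by exact H; field; lra.
    + rewrite sign_eq_1, Rabs_right by lra; field; lra.
Qed.

Lemma is_derive_ln_erf_factor (e : R) (rho : R -> R) (x t : R) :
  e = 1 \/ e = -1 ->
  is_derive (fun y : R => ln (erf_factor e rho y t)) x
    (erf_factor_dx e rho x t / erf_factor e rho x t).
Proof.
  intros He.
  apply (is_derive_comp ln (fun y => erf_factor e rho y t)).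
  - apply is_derive_Reals, derivable_pt_lim_ln, erf_factor_pos, He.
  - apply is_derive_erf_factor_x.
Qed.

(** The positive error-function factor of the law cancels the denominator of the logarithmic
    derivative, so the flux contains no quotient. *)
Lemma drift_mult_Pi_skew (e : R) (rho : R -> R) (x t : R) :
  e = 1 \/ e = -1 ->
  drift e rho x t * Pi_skew e rho x t =
    psi rho t * (half_heat x t * erf_factor_dx e rho x t).
Proof.
  intros He; unfold drift.
  rewrite (is_derive_unique _ _ _ (is_derive_ln_erf_factor e rho x t He)).
  pose proof (erf_factor_pos e rho x t He).
  change (Pi_skew e rho x t) with (half_heat x t * erf_factor e rho x t).
  field; lra.
Qed.

(** The conjuncts before the equation certify that [psi] and [drift] are built from genuine
    derivatives and from logarithms of positive numbers, not from default values. *)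
Theorem proposition2 (rho : R -> R)
  (rho_corr : forall t : R, 0 < t -> -1 <= rho t <= 1)
  (e : R) (e_sign : e = 1 \/ e = -1)
  (t : R) (t_pos : 0 < t)
  (rho_diff : ex_derive rho t)
  (rho_neq0 : rho t <> 0)
  (rho_nondeg : rho t <> 1 /\ rho t <> -1) :
  ex_derive (fun s => ln (Rabs (rho s))) t /\
  (forall x : R,
      0 < erf_factor e rho x t /\
      ex_derive (fun y => ln (erf_factor e rho y t)) x) /\
  solves_FP_at (drift e rho) (Pi_skew e rho) t.
Proof.
  destruct rho_diff as [l Hl].
  assert (Hr : -1 < rho t < 1) by (specialize (rho_corr t t_pos); lra).
  pose proof (is_derive_ln_Rabs rho t l rho_neq0 Hl) as Hln.
  split; [eexists; exact Hln|].
  split.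
  { intro x; split; [apply erf_factor_pos, e_sign|].
    eexists; apply is_derive_ln_erf_factor, e_sign. }
  intro x.
  pose (F y := erf_factor e rho y t).
  pose (D y := erf_factor_dx e rho y t).
  pose (G y := half_heat y t).
  assert (Ht : is_derive (fun s : R => Pi_skew e rho x s) t
    ((x ^ 2 / (2 * t ^ 2) - / (2 * t)) * G x * F x
     + G x * (x * (l / (rho t * (1 - rho t ^ 2)) - / (2 * t)) * D x))).
  { apply (is_derive_mult (fun s => half_heat x s) (fun s => erf_factor e rho x s)).
    - apply is_derive_half_heat_t, t_pos.
    - apply is_derive_erf_factor_t; assumption.
    - intros; apply Rmult_comm. }
  assert (Hx : forall y, is_derive (fun y => Pi_skew e rho y t) y
                           (G y * (D y - y / t * F y))).
  { intro y; apply (is_derive_half_heat_mult F); [exact t_pos|].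
    apply is_derive_erf_factor_x. }
  assert (Hxx : is_derive (Derive (fun y => Pi_skew e rho y t)) x
    (G x * (- 2 * Zfun rho t ^ 2 * x * D x - (/ t * F x + x / t * D x)
            - x / t * (D x - x / t * F x)))).
  (* Second use of the product rule, now with [g = D - (y / t) F]. *)
  { apply is_derive_ext with (fun y => G y * (D y - y / t * F y)).
    - intro y; symmetry; apply is_derive_unique, Hx.
    - apply (is_derive_half_heat_mult (fun y => D y - y / t * F y));
        [exact t_pos|].
      apply (is_derive_minus D (fun y => y / t * F y));
        [apply is_derive_erf_factor_dx|].
      apply (is_derive_mult (fun y => y / t) F).
      + auto_derive; [auto | field; lra].
      + apply is_derive_erf_factor_x.
      + intros; apply Rmult_comm. }
  assert (Hf : is_derive (fun y : R => drift e rho y t * Pi_skew e rho y t) x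
    (psi rho t * (G x * (- 2 * Zfun rho t ^ 2 * x * D x - x / t * D x)))).
  { apply is_derive_ext with (fun y => psi rho t * (G y * D y)).
    - intro y; symmetry; apply drift_mult_Pi_skew, e_sign.
    - apply (is_derive_scal (fun y => G y * D y)).
      apply (is_derive_half_heat_mult D); [exact t_pos|].
      apply is_derive_erf_factor_dx. }
  repeat split; try (eexists; eassumption).
  { eexists; apply Hx. }
  change (Derive_n (fun y => Pi_skew e rho y t) 2 x)
    with (Derive (Derive (fun y => Pi_skew e rho y t)) x).
  rewrite (is_derive_unique _ _ _ Ht), (is_derive_unique _ _ _ Hf),
    (is_derive_unique _ _ _ Hxx).
  unfold psi; rewrite (is_derive_unique _ _ _ Hln), (Zfun_sqr rho t t_pos Hr).
  (* The terms in [F] match by the heat equation. Those in [D] match because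
     [2 Z ^ 2 + 1 / t = 1 / (t (1 - rho ^ 2))], so that [psi] times this sum yields
     [l / (rho (1 - rho ^ 2))] and multiples of [1 / t] and [Z ^ 2]. *)
  field; repeat split; nra.
Qed.
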